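(* Let $\mathbb{T}^2$ be the torus. Then $\Gamma_2(B_2(\mathbb{T}^2))\cap Z(B_2(\mathbb{T}^2))=\{1\}$, where $Z(\cdot)$ denotes the centre.
   Context: $B_2(\mathbb{T}^2)$ is the fundamental group of the space of unordered pairs of distinct points of the torus; $\Gamma_2(G)=[G,G]$. *)

(* Defs.v *)
(* Plain MathComp (boot) world: B_2(T^2) given by Bellingeri's finite
   presentation, realised as words modulo the congruence generated by the
   relators (i.e. the free group modulo the normal closure of the relators). *)
From mathcomp Require Import all_boot.
From Stdlib Require Import Relation_Operators.

Set Implicit Arguments.
Unset Strict Implicit.
Unset Printing Implicit Defensive.

(* Generators of B_2(T^2): a, b (loops of the first strand along the two
   generating cycles of the torus) and sigma (= sigma_1, the half twist). *)
Inductive gen := gen_a | gen_b | gen_s.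

(* A letter is a generator together with an exponent sign:
   (g, false) = g, (g, true) = g^{-1}. *)
Definition letter := (gen * bool)%type.
Definition word := seq letter.

Definition winv (w : word) : word := rev (map (fun x => (x.1, ~~ x.2)) w).

Definition a  : word := [:: (gen_a, false)].
Definition A  : word := [:: (gen_a, true)].
Definition b  : word := [:: (gen_b, false)].
Definition B  : word := [:: (gen_b, true)].
Definition s  : word := [:: (gen_s, false)].
Definition S  : word := [:: (gen_s, true)].

(* Bellingeri's presentation of B_n(T^2)
   specialised to n = 2:
     sigma^-1 a sigma^-1 a = a sigma^-1 a sigma^-1
     sigma^-1 b sigma^-1 b = b sigma^-1 b sigma^-1
     sigma^-1 a sigma^-1 b = b sigma^-1 a sigma
     a b^-1 a^-1 b = sigma^2
   together with the free-group cancellation relators x x^-1. *)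
Inductive is_relator : word -> Prop :=
  | rel_free (x : letter) : is_relator [:: x; (x.1, ~~ x.2)]
  | rel_R2a : is_relator ((S ++ a ++ S ++ a) ++ winv (a ++ S ++ a ++ S))
  | rel_R2b : is_relator ((S ++ b ++ S ++ b) ++ winv (b ++ S ++ b ++ S))
  | rel_R3  : is_relator ((S ++ a ++ S ++ b) ++ winv (b ++ S ++ a ++ s))
  | rel_TR  : is_relator ((a ++ B ++ A ++ b) ++ winv (s ++ s)).

Inductive step : word -> word -> Prop :=
  | step_ins (u v r : word) : is_relator r -> step (u ++ v) (u ++ r ++ v).

Definition weq : word -> word -> Prop := clos_refl_sym_trans word step.

(* Group operations on representatives: product = concatenation,
   identity = [::], inverse = winv. *)
Definition wcomm (x y : word) : word := winv x ++ winv y ++ x ++ y.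

Definition in_Gamma2 (w : word) : Prop :=
  exists l : seq (word * word),
    weq w (flatten (map (fun p => wcomm p.1 p.2) l)).

Definition in_center (w : word) : Prop :=
  forall g : word, weq (w ++ g) (g ++ w).

(* Main.v *)
From HB Require Import structures.
Require Import Defs.
From Stdlib Require Import Relation_Operators Setoid Morphisms ZArith Lia.
From mathcomp Require Import all_boot.

Set Implicit Arguments.
Unset Strict Implicit.
Unset Printing Implicit Defensive.

(* Put t = b s^-1 a, z1 = (a s^-1)^2 and z2 = (b s^-1)^2.  The relators make z1 and
   z2 central and give t^2 = z1 z2, a t = z1 t a^-1, b t = z2 t b^-1 and
   s = t z2^-1 a^-1 b.  Hence every element is z1^m1 z2^m2 t^e f with e in {0, 1}
   and f a reduced word in a, b.  Right multiplication by the generators defines an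
   action on such quadruples (e, m1, m2, f) under which every relator acts trivially,
   so the normal form is unique.  An element commuting with a and b then has e = 0
   and f = 1, so it is z1^m1 z2^m2, whose exponent sums in a and b are 2 m1 and
   2 m2; both vanish on the commutator subgroup. *)

Definition gen_eqb (x y : gen) : bool :=
  match x, y with
  | gen_a, gen_a | gen_b, gen_b | gen_s, gen_s => true
  | _, _ => false
  end.

Lemma gen_eqP : Equality.axiom gen_eqb.
Proof. by case; case; constructor. Qed.

HB.instance Definition _ := hasDecEq.Build gen gen_eqP.

Definition linv (l : letter) : letter := (l.1, ~~ l.2).

Lemma linvK : involutive linv.
Proof. by case=> g []. Qed.

Lemma linv_inj : injective linv.
Proof. exact: inv_inj linvK. Qed.

Lemma winv_cat u v : winv (u ++ v) = winv v ++ winv u.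
Proof. by rewrite /winv map_cat rev_cat. Qed.

Lemma winv_cons l u : winv (l :: u) = winv u ++ [:: linv l].
Proof. by rewrite -cat1s winv_cat. Qed.

Lemma winvK : involutive winv.
Proof.
elim=> [|l u IHu] //; rewrite winv_cons winv_cat IHu.
by rewrite /winv /= negbK -surjective_pairing.
Qed.

Lemma weq_refl u : weq u u. Proof. exact: rst_refl. Qed.
#[export] Hint Resolve weq_refl : core.

#[export] Instance weq_Equivalence : Equivalence weq.
Proof. split; [exact: weq_refl | exact: rst_sym | exact: rst_trans]. Qed.

Lemma step_cat2 p q u v : step u v -> step (p ++ u ++ q) (p ++ v ++ q).
Proof.
case=> x y r hr.
by rewrite -!catA catA [p ++ (x ++ r ++ y ++ q)]catA; constructor.
Qed.

Lemma weq_cat2 p q u v : weq u v -> weq (p ++ u ++ q) (p ++ v ++ q).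
Proof.
elim=> [x y hxy | x | x y _ IH | x y z _ IH1 _ IH2].
- exact: rst_step (step_cat2 p q hxy).
- by [].
- by symmetry.
- by transitivity (p ++ y ++ q).
Qed.

#[export] Instance cat_weq_Proper : Proper (weq ==> weq ==> weq) (@cat letter).
Proof.
move=> u v huv u' v' huv'.
transitivity (v ++ u').
- by have := weq_cat2 [::] u' huv.
- by have := weq_cat2 v [::] huv'; rewrite !cats0.
Qed.

Lemma weq_relator r : is_relator r -> weq r [::].
Proof.
move=> hr; symmetry; apply: rst_step.
by have := @step_ins [::] [::] r hr; rewrite /= cats0.
Qed.

Lemma weq_linv l : weq [:: l; linv l] [::].
Proof. exact: weq_relator (rel_free l). Qed.

Lemma weq_catV u : weq (u ++ winv u) [::].
Proof.
elim: u => [|l u IHu] //.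
rewrite winv_cons catA -cat1s -(catA [:: l]) IHu.
exact: weq_linv.
Qed.

Lemma weq_Vcat u : weq (winv u ++ u) [::].
Proof. by have := weq_catV (winv u); rewrite winvK. Qed.

Lemma weq_catKV u v : weq (u ++ v ++ winv v) u.
Proof. by rewrite weq_catV cats0. Qed.

Lemma weq_catVK u v : weq (u ++ winv v ++ v) u.
Proof. by rewrite weq_Vcat cats0. Qed.

#[export] Instance winv_weq_Proper : Proper (weq ==> weq) winv.
Proof.
move=> u v h.
rewrite -(weq_catKV (winv u) v) catA; set w := winv v.
by rewrite -h weq_Vcat.
Qed.

Lemma weq_eq_cat_winv u v : weq (u ++ winv v) [::] -> weq u v.
Proof. by move=> h; rewrite -(weq_catVK u v) catA h. Qed.

(** * Free reduction *)

(* A stack holds a word in reverse order: [push] appends a letter on the right,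
   cancelling it against the last letter when possible. *)
Definition push (st : word) (l : letter) : word :=
  if st is l' :: st' then (if l' == linv l then st' else l :: st) else [:: l].

Definition reduce (w : word) : word := rev (foldl push [::] w).

Fixpoint reduced (w : word) : bool :=
  if w is x :: ((y :: _) as w') then (y != linv x) && reduced w' else true.

Lemma reduced_cons l w : reduced (l :: w) -> reduced w.
Proof. by case: w => //= y w /andP []. Qed.

Lemma reduced_catl u v : reduced (u ++ v) -> reduced u.
Proof.
elim: u => [|x u IHu] //=; case: u IHu => [|y u] IHu //=.
by case/andP=> -> /IHu.
Qed.

Lemma reduced_rcons f y x : reduced (rcons f y) -> x != linv y -> reduced (rcons (rcons f y) x).
Proof.
elim: f => [|z f IHf] /=; first by move=> _ ->.
by case: f IHf => [|w f] IHf /= /andP [-> /IHf].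
Qed.

Lemma reduced_push st l : reduced st -> reduced (push st l).
Proof.
case: st => [|l' st] //=; case: eqP => [_ /reduced_cons // | ne h].
by rewrite /= h andbT; apply/eqP.
Qed.

Lemma reduced_foldl_push st w : reduced st -> reduced (foldl push st w).
Proof. by elim: w st => //= l w IHw st /(reduced_push l)/IHw. Qed.

Lemma weq_push st l : weq (rev st ++ [:: l]) (rev (push st l)).
Proof.
case: st => [|l' st] //=; case: eqP => [-> | _]; last by rewrite (rev_cons l) cats1.
by rewrite rev_cons -cats1 -catA /= -{2}(linvK l) weq_linv cats0.
Qed.

Lemma weq_foldl_push st w : weq (rev st ++ w) (rev (foldl push st w)).
Proof.
elim: w st => [|l w IHw] st /=; first by rewrite cats0.
by rewrite -IHw -(weq_push st l) -catA.
Qed.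

Lemma weq_reduce w : weq w (reduce w).
Proof. exact: (weq_foldl_push [::] w). Qed.

Lemma push_pushV st l : reduced st -> push (push st l) (linv l) = st.
Proof.
case: st => [|l' st] /=; first by rewrite linvK eqxx.
case: eqP => [-> | _] h /=; last by rewrite linvK eqxx.
by case: st h => [|l'' st] //= /andP [+ _]; rewrite linvK => /negbTE ->.
Qed.

Lemma foldl_push_rev_push st k l : reduced st ->
  foldl push st (rev (push k l)) = push (foldl push st (rev k)) l.
Proof.
case: k => [|l' k] //= hst; rewrite rev_cons foldl_rcons.
case: eqP => [-> | _]; last by rewrite !rev_cons !foldl_rcons.
by rewrite -{2}(linvK l) push_pushV // reduced_foldl_push.
Qed.

Lemma foldl_push_reduce st w : reduced st -> foldl push st (reduce w) = foldl push st w.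
Proof.
move=> hst; elim/last_ind: w => [|w l IHw] //.
by rewrite /reduce !foldl_rcons foldl_push_rev_push // IHw.
Qed.

Lemma foldl_push_rev_reduced st k : reduced (st ++ k) -> foldl push k (rev st) = st ++ k.
Proof.
elim: st => [|l st IHst] //= h; rewrite rev_cons foldl_rcons IHst; last first.
  by case: (st ++ k) h => //= y w /andP [].
by case: (st ++ k) h => [|y w] //= /andP [/negbTE ->].
Qed.

Lemma foldl_push_rev st : reduced st -> foldl push [::] (rev st) = st.
Proof. by move=> h; have := @foldl_push_rev_reduced st [::]; rewrite cats0; apply. Qed.

Lemma rev_foldl_push st w : reduced st -> rev (foldl push st w) = reduce (rev st ++ w).
Proof. by move=> h; rewrite /reduce foldl_cat foldl_push_rev. Qed.

(** * Checking identities by chains of relator rewrites *)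

Definition relators : seq word :=
  [:: (S ++ a ++ S ++ a) ++ winv (a ++ S ++ a ++ S);
      (S ++ b ++ S ++ b) ++ winv (b ++ S ++ b ++ S);
      (S ++ a ++ S ++ b) ++ winv (b ++ S ++ a ++ s);
      (a ++ B ++ A ++ b) ++ winv (s ++ s)].

Definition rotations (r : word) : seq word := [seq rot i r | i <- iota 0 (size r)].

(* A rule [(p, q)] says that [p] may be replaced by [q]; [p ++ winv q] is a
   cyclic conjugate of a relator or of its inverse. *)
Definition relator_rules : seq (word * word) :=
  flatten [seq [seq (take k r, winv (drop k r)) | k <- iota 0 (size r).+1]
          | r <- flatten [seq rotations r ++ rotations (winv r) | r <- relators]].

Definition rule_step (x y : word) : bool :=
  has (fun i => has (fun pq => (take (size pq.1) (drop i x) == pq.1) &&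
        (reduce (take i x ++ pq.2 ++ drop (i + size pq.1) x) == y)) relator_rules)
    (iota 0 (size x).+1).

Lemma weq_rot_nil i r : weq r [::] -> weq (rot i r) [::].
Proof.
rewrite -{1}(cat_take_drop i r) /rot => h.
by rewrite -(weq_catKV (_ ++ _) (drop i r)) -catA (catA (take i r)) h weq_catV.
Qed.

Lemma relator_rulesP pq : pq \in relator_rules -> weq pq.1 pq.2.
Proof.
case/flattenP=> _ /mapP [r /flattenP [_ /mapP [r0 hr0 ->] hr] ->] /mapP [k _ ->] /=.
apply: weq_eq_cat_winv; rewrite winvK cat_take_drop.
have hr0W : weq r0 [::].
  by move: hr0; rewrite !inE => /or4P [] /eqP ->; apply: weq_relator; constructor.
by move: hr; rewrite mem_cat => /orP [] /mapP [i _ ->]; apply: weq_rot_nil;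
  rewrite hr0W.
Qed.

Lemma rule_stepP x y : rule_step x y -> weq x y.
Proof.
case/hasP=> i _ /hasP [[p q] /relator_rulesP /= hpq] /andP [/eqP hp /eqP <-].
rewrite -weq_reduce addnC -drop_drop.
rewrite -{1}(cat_take_drop i x) -{1}(cat_take_drop (size p) (drop i x)) hp.
by set n := size p; rewrite hpq.
Qed.

(* [ys] lists the successive reduced words of a derivation of [u v^-1 = 1]. *)
Lemma weq_by_rule_path u v ys :
  path rule_step (reduce (u ++ winv v)) ys && (last (reduce (u ++ winv v)) ys == [::]) ->
  weq u v.
Proof.
case/andP=> hpath /eqP hlast; apply: weq_eq_cat_winv; rewrite (weq_reduce (u ++ winv v)).
move: (reduce (u ++ winv v)) hpath hlast; elim: ys => [|y ys IHys] x /=; first by move=> _ ->.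
by case/andP=> /rule_stepP -> /IHys.
Qed.

Definition wcommute (u v : word) : Prop := weq (u ++ v) (v ++ u).

Definition central (z : word) : Prop := forall v, wcommute z v.

Lemma wcommute_catr z x y : wcommute z x -> wcommute z y -> wcommute z (x ++ y).
Proof. by rewrite /wcommute => hx hy; rewrite catA hx -catA hy catA. Qed.

Lemma wcommute_winvr z x : wcommute z x -> wcommute z (winv x).
Proof.
rewrite /wcommute => h; transitivity (winv x ++ (x ++ z) ++ winv x).
  by rewrite !catA weq_Vcat.
by rewrite -h -catA weq_catKV.
Qed.

Lemma central_gens z :
  wcommute z a -> wcommute z b -> wcommute z s -> central z.
Proof.
move=> ha hb hs; elim=> [|l v IHv]; first by rewrite /wcommute cats0.
rewrite -cat1s; apply: wcommute_catr IHv.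
case: l => -[] [];
  [exact: wcommute_winvr ha | exact: ha | exact: wcommute_winvr hb | exact: hb
  | exact: wcommute_winvr hs | exact: hs].
Qed.

Lemma central_nil : central [::].
Proof. by move=> v; rewrite /wcommute cats0. Qed.

Lemma central_cat z z' : central z -> central z' -> central (z ++ z').
Proof. by move=> hz hz' v; rewrite /wcommute -catA hz' catA hz catA. Qed.

Lemma central_winv z : central z -> central (winv z).
Proof.
move=> hz v; rewrite /wcommute; symmetry; apply: wcommute_winvr.
by rewrite /wcommute; symmetry; apply: hz.
Qed.

Lemma central_move z u v : central z -> weq (u ++ z ++ v) (z ++ u ++ v).
Proof. by move=> hz; rewrite catA -hz catA. Qed.

Local Open Scope Z_scope.

Definition wpow (z : word) (k : Z) : word :=
  if 0 <=? k then flatten (nseq (Z.to_nat k) z)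
  else flatten (nseq (Z.to_nat (- k)) (winv z)).

Lemma flatten_nseqS n (x : word) : flatten (nseq n.+1 x) = flatten (nseq n x) ++ x.
Proof. by rewrite -addn1 nseqD flatten_cat /= cats0. Qed.

Lemma central_wpow z k : central z -> central (wpow z k).
Proof.
have central_flatten_nseq n x : central x -> central (flatten (nseq n x)).
  by move=> hx; elim: n => [|n IHn]; [exact: central_nil | exact: central_cat].
rewrite /wpow => hz; case: ifP => _; apply: central_flatten_nseq => //.
exact: central_winv.
Qed.

Lemma wpowS z k : weq (wpow z k ++ z) (wpow z (k + 1)).
Proof.
rewrite /wpow; case: (Z.leb_spec 0 k) => hk.
  have -> : (0 <=? k + 1) = true by apply/Z.leb_le; lia.
  by rewrite (_ : Z.to_nat (k + 1) = (Z.to_nat k).+1) ?flatten_nseqS //; lia.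
rewrite (_ : Z.to_nat (- k) = (Z.to_nat (- (k + 1))).+1) ?flatten_nseqS; last by lia.
rewrite -catA weq_Vcat cats0; case: Z.leb_spec => // hk1.
by rewrite (_ : k + 1 = 0) //; lia.
Qed.

Lemma wpowD z i j : weq (wpow z i ++ wpow z j) (wpow z (i + j)).
Proof.
elim/Z.peano_ind: j => [|j IHj|j IHj]; first by rewrite Z.add_0_r cats0.
  by rewrite -Z.add_1_r -wpowS catA IHj Z.add_assoc wpowS.
have wpowP k : weq (wpow z k ++ winv z) (wpow z (k - 1)).
  by rewrite -{1}(Z.sub_add 1 k) -wpowS -catA weq_catV cats0.
by rewrite -Z.sub_1_r -wpowP catA IHj wpowP Z.add_sub_assoc.
Qed.

(** * Exponent sums *)

Definition lsign (g : gen) (l : letter) : Z :=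
  if l.1 == g then (if l.2 then -1 else 1) else 0.

Definition expsum (g : gen) (w : word) : Z := foldr (fun l n => lsign g l + n) 0 w.

Lemma lsign_linv g l : lsign g (linv l) = - lsign g l.
Proof. by case: l => h []; rewrite /lsign /=; case: (h == g). Qed.

Lemma expsum_cat g u v : expsum g (u ++ v) = expsum g u + expsum g v.
Proof. by elim: u => //= l u ->; lia. Qed.

Lemma expsum_rev g u : expsum g (rev u) = expsum g u.
Proof. by elim: u => //= l u IHu; rewrite rev_cons -cats1 expsum_cat IHu /=; lia. Qed.

Lemma expsum_map_linv g u : expsum g (map linv u) = - expsum g u.
Proof. by elim: u => //= l u ->; rewrite lsign_linv; lia. Qed.

Lemma expsum_winv g u : expsum g (winv u) = - expsum g u.
Proof. exact: (etrans (expsum_rev _ _) (expsum_map_linv _ _)). Qed.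

Lemma expsum_push g st l : expsum g (push st l) = expsum g st + lsign g l.
Proof.
case: st => [|l' st] /=; first lia.
by case: eqP => [-> | _] /=; rewrite ?lsign_linv; lia.
Qed.

Lemma expsum_foldl_push g st w : expsum g (foldl push st w) = expsum g st + expsum g w.
Proof. by elim: w st => /= [|l w IHw] st; rewrite ?IHw ?expsum_push; lia. Qed.

Lemma expsum_relator g r : g != gen_s -> is_relator r -> expsum g r = 0.
Proof. by case: g => // _; case=> [[[] []]||||]. Qed.

Lemma expsum_weq g u v : g != gen_s -> weq u v -> expsum g u = expsum g v.
Proof.
move=> hg; elim=> [_ _ [x y r hr] | | | ] //=; last by move=> ? ? ? _ -> _ ->.
by rewrite !expsum_cat (expsum_relator hg hr); lia.
Qed.

Lemma expsum_Gamma2 g w : g != gen_s -> in_Gamma2 w -> expsum g w = 0.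
Proof.
move=> hg [l /(expsum_weq hg) ->]; elim: l => //= p l IHl.
by rewrite expsum_cat IHl /wcomm !expsum_cat !expsum_winv; lia.
Qed.

Definition t : word := b ++ S ++ a.
Definition z1 : word := a ++ S ++ a ++ S.
Definition z2 : word := b ++ S ++ b ++ S.

Definition zeta (m1 m2 : Z) : word := wpow z1 m1 ++ wpow z2 m2.

Lemma z1_central : central z1.
Proof.
apply: central_gens.
- by apply: (@weq_by_rule_path _ _ [:: [::]]); vm_compute.
- by apply: (@weq_by_rule_path _ _
    [:: S ++ a ++ S ++ a ++ b ++ s ++ A ++ s ++ A ++ B;
        S ++ a ++ S ++ a ++ b ++ A ++ s ++ A ++ s ++ B;
        S ++ a ++ S ++ b ++ S ++ A ++ s ++ B; [::]]); vm_compute.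
- by apply: (@weq_by_rule_path _ _ [:: [::]]); vm_compute.
Qed.

Lemma z2_central : central z2.
Proof.
apply: central_gens.
- by apply: (@weq_by_rule_path _ _ [:: b ++ S ++ S ++ a ++ B ++ A; [::]]); vm_compute.
- by apply: (@weq_by_rule_path _ _ [:: [::]]); vm_compute.
- by apply: (@weq_by_rule_path _ _ [:: [::]]); vm_compute.
Qed.

Lemma zeta_central m1 m2 : central (zeta m1 m2).
Proof. by apply: central_cat; apply: central_wpow; [exact: z1_central | exact: z2_central]. Qed.

Lemma zetaD m1 m2 n1 n2 : weq (zeta m1 m2 ++ zeta n1 n2) (zeta (m1 + n1) (m2 + n2)).
Proof.
rewrite /zeta -!catA (central_move (wpow z2 m2) _ (central_wpow n1 z1_central)).
by rewrite catA !wpowD.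
Qed.

Lemma t_mul_t : weq (t ++ t) (zeta 1 1).
Proof.
by apply: (@weq_by_rule_path _ _
  [:: b ++ S ++ a ++ S ++ a ++ B ++ s ++ A ++ s ++ A;
      b ++ S ++ a ++ S ++ a ++ B ++ A ++ s ++ A ++ s;
      b ++ S ++ a ++ s ++ B ++ s ++ A ++ s; [::]]); vm_compute.
Qed.

Definition sigma_tail (inv : bool) : word := if inv then b ++ A else A ++ b.

Lemma sigma_in_t_coset inv : weq [:: (gen_s, inv)] (t ++ zeta 0 (-1) ++ sigma_tail inv).
Proof.
case: inv; first by apply: (@weq_by_rule_path _ _ [:: [::]]); vm_compute.
by apply: (@weq_by_rule_path _ _ [:: s ++ B ++ a ++ b ++ A ++ s; [::]]); vm_compute.
Qed.

Definition ab_letter (l : letter) : bool := l.1 != gen_s.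

Lemma t_conj_letter l : ab_letter l ->
  weq ([:: l] ++ t) (zeta (lsign gen_a l) (lsign gen_b l) ++ t ++ [:: linv l]).
Proof.
case: l => -[] [] // _.
- by apply: (@weq_by_rule_path _ _
    [:: A ++ s ++ A ++ s ++ a ++ S ++ a ++ S; [::]]); vm_compute.
- by apply: (@weq_by_rule_path _ _ [:: [::]]); vm_compute.
- by apply: (@weq_by_rule_path _ _ [:: [::]]); vm_compute.
- by apply: (@weq_by_rule_path _ _
    [:: b ++ b ++ S ++ b ++ S ++ B ++ s ++ B ++ s ++ B; [::]]); vm_compute.
Qed.

(** * A faithful model of the group *)

Lemma map_linvK : involutive (map linv).
Proof. exact: mapK linvK. Qed.

Lemma map_linv_push st l : map linv (push st l) = push (map linv st) (linv l).
Proof. by case: st => [|l' st] //=; rewrite (inj_eq linv_inj); case: eqP. Qed.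

Lemma map_linv_foldl_push st w :
  map linv (foldl push st w) = foldl push (map linv st) (map linv w).
Proof. by elim: w st => //= l w IHw st; rewrite IHw map_linv_push. Qed.

Lemma reduced_map_linv st : reduced (map linv st) = reduced st.
Proof.
elim: st => [|x st IHst] //; case: st IHst => [|y st] //= ->.
by rewrite (inj_eq linv_inj).
Qed.

Definition ab_reduced (f : word) : bool := reduced f && all ab_letter f.

Lemma ab_reduced_push f l : ab_letter l -> ab_reduced f -> ab_reduced (push f l).
Proof.
move=> hl /andP [hf hfab]; rewrite /ab_reduced reduced_push //=.
case: f hf hfab => [|l' f] /=; first by rewrite hl.
by case: eqP => _ _ /andP [] //= -> ->; rewrite hl.
Qed.

Lemma ab_reduced_foldl_push f w : all ab_letter w -> ab_reduced f -> ab_reduced (foldl push f w).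
Proof. by elim: w f => //= l w IHw f /andP [hl hw] hf; apply/IHw/ab_reduced_push. Qed.

Lemma ab_reduced_map_linv f : ab_reduced f -> ab_reduced (map linv f).
Proof. by rewrite /ab_reduced reduced_map_linv all_map => /andP [-> /sub_all->] // -[]. Qed.

(* [NormalForm e m1 m2 f] stands for [z1^m1 z2^m2 t^e (rev f)]: the stack [f]
   is a freely reduced word in [a], [b] read from right to left. *)
Record normal_form := NormalForm { nf_t : bool; nf_m1 : Z; nf_m2 : Z; nf_stack : word }.

Definition nf1 : normal_form := NormalForm false 0 0 [::].

Definition nf_wf (g : normal_form) : bool := ab_reduced (nf_stack g).

Definition nf_act (g : normal_form) (l : letter) : normal_form :=
  let: NormalForm e m1 m2 f := g in
  if l is (gen_s, inv) then
    NormalForm (~~ e) (m1 + expsum gen_a f + Z.b2z e) (m2 + expsum gen_b f - 1 + Z.b2z e)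
      (foldl push (map linv f) (sigma_tail inv))
  else NormalForm e m1 m2 (push f l).

Definition nf_mul (h k : normal_form) : normal_form :=
  let: NormalForm e1 m1 m2 f1 := h in
  let: NormalForm e2 n1 n2 f2 := k in
  NormalForm (e1 (+) e2)
    (m1 + n1 + (if e2 then expsum gen_a f1 else 0) + Z.b2z (e1 && e2))
    (m2 + n2 + (if e2 then expsum gen_b f1 else 0) + Z.b2z (e1 && e2))
    (foldl push (if e2 then map linv f1 else f1) (rev f2)).

Definition nf_eval (w : word) : normal_form := foldl nf_act nf1 w.

Lemma nf_wf_act g l : nf_wf g -> nf_wf (nf_act g l).
Proof.
case: g => e m1 m2 f; case: l => -[] inv hf; rewrite /nf_wf /=; try exact: ab_reduced_push.
by apply: ab_reduced_foldl_push; [case: inv | exact: ab_reduced_map_linv].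
Qed.

Lemma nf_wf_foldl_act g w : nf_wf g -> nf_wf (foldl nf_act g w).
Proof. by elim: w g => //= l w IHw g /(nf_wf_act l)/IHw. Qed.

Lemma nf_wf_eval w : nf_wf (nf_eval w).
Proof. exact: nf_wf_foldl_act. Qed.

Lemma nf_mulg1 h : nf_mul h nf1 = h.
Proof. by case: h => e m1 m2 f /=; rewrite addbF andbF /=; congr NormalForm; lia. Qed.

Lemma nf_act_mul h k l : nf_wf h -> nf_wf k ->
  nf_act (nf_mul h k) l = nf_mul h (nf_act k l).
Proof.
case: h => e1 m1 m2 f1; case: k => e2 n1 n2 f2; rewrite /nf_wf /= => /andP [hf1 _] /andP [hf2 _].
have hf1' : reduced (if e2 then map linv f1 else f1) by case: e2; rewrite ?reduced_map_linv.
case: l => -[] inv /=; rewrite ?foldl_push_rev_push //.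
rewrite map_linv_foldl_push.
have -> : map linv (if e2 then map linv f1 else f1) = if ~~ e2 then map linv f1 else f1.
  by case: e2 hf1' => /=; rewrite ?map_linvK.
rewrite map_rev rev_foldl_push ?reduced_map_linv // foldl_push_reduce.
  rewrite foldl_cat !expsum_foldl_push !expsum_rev.
  by case: e1; case: e2 hf1' => _; rewrite /= ?expsum_map_linv; congr NormalForm; lia.
by case: (~~ e2); rewrite ?reduced_map_linv.
Qed.

Lemma foldl_nf_act h w : nf_wf h -> foldl nf_act h w = nf_mul h (nf_eval w).
Proof.
move=> hh; rewrite -{1}(nf_mulg1 h) /nf_eval.
have : nf_wf nf1 by [].
elim: w nf1 => //= l w IHw k hk.
by rewrite nf_act_mul // IHw // nf_wf_act.
Qed.

Lemma nf_eval_cat u v : nf_eval (u ++ v) = nf_mul (nf_eval u) (nf_eval v).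
Proof. by rewrite /nf_eval foldl_cat foldl_nf_act // nf_wf_eval. Qed.

Lemma nf_eval_weq u v : weq u v -> nf_eval u = nf_eval v.
Proof.
have eval_relator r : is_relator r -> nf_eval r = nf1 by case=> [[[] []]||||]; vm_compute.
elim=> [_ _ [x y r /eval_relator hr] | | | x y z _ -> _ ->] //.
by rewrite /nf_eval !foldl_cat (foldl_nf_act r (nf_wf_eval x)) hr nf_mulg1.
Qed.

Definition nf_word (g : normal_form) : word :=
  zeta (nf_m1 g) (nf_m2 g) ++ (if nf_t g then t else [::]) ++ rev (nf_stack g).

Lemma rev_cat_t f : all ab_letter f ->
  weq (rev f ++ t) (zeta (expsum gen_a f) (expsum gen_b f) ++ t ++ rev (map linv f)).
Proof.
elim: f => [_ | l f IHf /andP [hl hf]] //.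
rewrite rev_cons -cats1 -catA t_conj_letter // (central_move _ _ (zeta_central _ _)).
rewrite (catA (rev f)) IHf // -(catA (zeta _ _)) (catA (zeta _ _) (zeta _ _)) zetaD.
by rewrite -(catA t) rev_cons -cats1.
Qed.

Lemma tpow_cat_t e :
  weq ((if e then t else [::]) ++ t) (zeta (Z.b2z e) (Z.b2z e) ++ if ~~ e then t else [::]).
Proof. by case: e; rewrite ?t_mul_t ?cats0. Qed.

Lemma rev_cat_sigma f inv : all ab_letter f ->
  weq (rev f ++ [:: (gen_s, inv)])
      (zeta (expsum gen_a f) (expsum gen_b f - 1) ++ t ++
       rev (foldl push (map linv f) (sigma_tail inv))).
Proof.
move=> hf; rewrite sigma_in_t_coset (catA (rev f)) rev_cat_t // -(catA (zeta _ _)) -(catA t).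
rewrite (central_move (rev (map linv f)) _ (zeta_central 0 (-1))).
rewrite (central_move t _ (zeta_central 0 (-1))) (catA (zeta _ _) (zeta _ _)) zetaD.
by rewrite weq_foldl_push Z.add_0_r.
Qed.

Lemma nf_word_act g l : nf_wf g -> weq (nf_word g ++ [:: l]) (nf_word (nf_act g l)).
Proof.
case: g => e m1 m2 f /andP [_ hf]; rewrite /nf_word -catA -(catA (if e then t else [::])).
case: l => -[] inv /=; try by rewrite weq_push.
rewrite rev_cat_sigma // (central_move (if e then t else [::]) _ (zeta_central _ _)).
rewrite (catA (if e then t else [::])) tpow_cat_t -(catA (zeta _ _)).
by do 2 rewrite (catA (zeta _ _) (zeta _ _)) zetaD; rewrite Z.add_sub_assoc.
Qed.

Lemma weq_nf_word_eval w : weq w (nf_word (nf_eval w)).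
Proof.
rewrite -[w in weq w _]cat0s /nf_eval.
have : nf_wf nf1 by [].
have -> : [::] = nf_word nf1 by [].
elim: w nf1 => [|l w IHw] g hg /=; first by rewrite cats0.
by rewrite -IHw ?nf_wf_act // -nf_word_act // -(catA (nf_word g)).
Qed.

Lemma expsum_wpow g z k : expsum g (wpow z k) = k * expsum g z.
Proof.
have expsum_flatten_nseq n x : expsum g (flatten (nseq n x)) = Z.of_nat n * expsum g x.
  by elim: n => [|n IHn] //; rewrite Nat2Z.inj_succ /= expsum_cat IHn Z.mul_succ_l; lia.
rewrite /wpow; case: Z.leb_spec => hk; rewrite expsum_flatten_nseq ?expsum_winv Z2Nat.id //.
  by rewrite Z.mul_opp_opp.
lia.
Qed.

Lemma expsum_zeta m1 m2 :
  expsum gen_a (zeta m1 m2) = 2 * m1 /\ expsum gen_b (zeta m1 m2) = 2 * m2.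
Proof.
rewrite !expsum_cat !expsum_wpow.
by split; rewrite [expsum _ z1]/= [expsum _ z2]/=; lia.
Qed.

(** * The centre *)

Lemma cons_eq_rcons (T : eqType) (x : T) u : x :: u = rcons u x -> all (pred1 x) u.
Proof. by elim: u => //= y u IHu [<- /IHu ->]; rewrite eqxx. Qed.

Lemma foldl_push_rev_rcons f y x : reduced (rcons f y) ->
  foldl push [:: x] (rev (rcons f y)) = if y == linv x then f else rcons (rcons f y) x.
Proof.
move=> hfy; rewrite rev_rcons /= -(inj_eq linv_inj) linvK eq_sym.
case: eqP => [_ | ne]; first by rewrite foldl_push_rev // (@reduced_catl f [:: y]) ?cats1.
have def_fyx : f ++ [:: y; x] = rcons (rcons f y) x by rewrite -!cats1 -catA.
rewrite foldl_push_rev_reduced def_fyx // reduced_rcons //.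
by apply/eqP=> hx; apply: ne; rewrite hx linvK.
Qed.

Lemma reduced_commute_letter f x : reduced f ->
  push f x = foldl push [:: x] (rev f) -> all (fun l => l.1 == x.1) f.
Proof.
have all_gen (c : letter) (s : word) : c.1 = x.1 -> all (pred1 c) s -> all (fun l => l.1 == x.1) s.
  by move=> hc; apply: sub_all => l /eqP ->; rewrite hc.
case/lastP: f => [|f y] // hfy; rewrite foldl_push_rev_rcons //.
case def_zg: (rcons f y) => [|z g]; first by case: f {hfy} def_zg.
have size_g : size g = size f by have := congr1 size def_zg; rewrite size_rcons => -[].
rewrite [push _ _]/=; case: eqP => hz; case: eqP => hy e.
- apply: (all_gen (linv x)) => //; rewrite /= hz eqxx e /=.
  by apply: cons_eq_rcons; rewrite -{1}hz -hy def_zg e.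
- by move/(congr1 size): e; rewrite size_rcons /=; lia.
- by move: size_g; rewrite -e /=; lia.
- exact: all_gen (cons_eq_rcons e).
Qed.

Lemma nf_eval_central w : in_center w -> exists m1 m2, nf_eval w = NormalForm false m1 m2 [::].
Proof.
have commute_gen x : in_center w -> nf_act (nf_eval w) x = nf_mul (nf_eval [:: x]) (nf_eval w).
  by move=> hw; rewrite -nf_eval_cat -(nf_eval_weq (hw [:: x])) /nf_eval foldl_cat.
move=> hw; have := commute_gen (gen_a, false) hw; have := commute_gen (gen_b, false) hw.
case: (nf_eval w) (nf_wf_eval w) => e m1 m2 f; rewrite /nf_wf /= => /andP [hf _].
move=> /(congr1 nf_stack) hfb ha; exists m1, m2.
have {ha} [hm1 hfa] := (congr1 nf_m1 ha, congr1 nf_stack ha).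
case: e hm1 hfa hfb => /=; first by rewrite /lsign /=; lia.
move=> _ /(reduced_commute_letter hf) hfa /(reduced_commute_letter hf) hfb.
by case: f hfa hfb {hf} => //= l f /andP [/eqP -> _] /andP [].
Qed.

Theorem proposition4p2 :
  forall w : word, in_Gamma2 w -> in_center w -> weq w [::].
Proof.
move=> w hG /nf_eval_central [m1 [m2 hw]].
have w_zeta : weq w (zeta m1 m2).
  transitivity (nf_word (nf_eval w)); first exact: weq_nf_word_eval.
  by rewrite hw /nf_word /= !cats0.
have [ha hb] := expsum_zeta m1 m2.
have := expsum_Gamma2 (g := gen_a) isT hG; rewrite (expsum_weq (g := gen_a) isT w_zeta) ha => m1_0.
have := expsum_Gamma2 (g := gen_b) isT hG; rewrite (expsum_weq (g := gen_b) isT w_zeta) hb => m2_0.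
by rewrite w_zeta (_ : m1 = 0) 1?(_ : m2 = 0) //; lia.
Qed.
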